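(* Let $A\in\mathbb{C}^{m\times n}$, $p\in[1,\infty]$, $q\in[0,1]$, let $\mathcal{Z}(A;p,q)\in\{0,1\}^{m\times n}$ be the $L_p$ norm based sparsity pattern of $A$, and let $A^{pq}:=\mathcal{Z}(A;p,q)\circ A$, where $\circ$ denotes the entry-wise product. Let $$C:=1-\frac1p+\left|\frac12-\frac1p\right|$$ (with $1/p=0$ for $p=\infty$). Then $$\|A-A^{pq}\|_2\le (mn)^{C/2}(1-q)\|A\|_2 ,$$ where $\|\cdot\|_2$ is the spectral norm.
   Context: Sparsity pattern $\mathcal{Z}(A;p,q)$. For a vector $x$ and $p\in[1,\infty]$, $\|x\|_p$ is the usual $\ell_p$ norm; $\|x\|_0$ is the number of nonzero entries; the empty vector has norm $0$. Vector pattern: given $x\in\mathbb{C}^k$ and an integer $N\ge0$, if $x=0$ the pattern is $0\in\{0,1\}^k$. Otherwise order indices so that $|x_{i_1}|\le\dots\le|x_{i_k}|$ (ties broken arbitrarily), let $z$ be the number of zero entries of $x$ and $N'=\min(N,\|x\|_0)$, and let $j$ be the largest integer in $\{z,\dots,k-N'\}$ with $\|(x_{i_1},\dots,x_{i_j})\|_p\le(1-q)\|x\|_p$. The pattern has entry $0$ at positions $i_1,\dots,i_j$ (eliminated entries) and $1$ at $i_{j+1},\dots,i_k$ (preserved entries). Matrix pattern: for given nonnegative integers $N_{row},N_{col}$ (minimum numbers of nonzeros to keep in each row and column), apply the vector pattern to each row with $N=N_{row}$ and to each column with $N=N_{col}$; $(\mathcal{Z}(A;p,q))_{ij}=1$ if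 the row pattern or the column pattern (or both) has a $1$ at position $(i,j)$, and $0$ otherwise. *)

(* Defs.v *)
From HB Require Import structures.
From mathcomp Require Import all_boot all_order all_algebra.
From mathcomp Require Import all_classical all_reals all_analysis.
From mathcomp Require Import complex.
Set Implicit Arguments.
Unset Strict Implicit.
Unset Printing Implicit Defensive.
Import Order.TTheory GRing.Theory Num.Theory.
Local Open Scope classical_set_scope.
Local Open Scope ring_scope.

Definition cmod (R : realType) (z : R[i]) : R := ComplexField.Normc.normc z.

(* Only used for 1 <= p; the value at p = -oo is irrelevant. On the empty
   vector (k = 0) it is 0, since 0 `^ r^-1 = 0 for r >= 1. *)
Definition lpnorm (R : realType) (p : \bar R) (k : nat) (x : 'rV[R[i]]_k) : R :=
  match p with
  | r%:E => (\sum_(i < k) cmod (x 0 i) `^ r) `^ r^-1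
  | +oo%E => \big[Num.max/0]_(i < k) cmod (x 0 i)
  | -oo%E => 0
  end.

Definition num_zero (R : realType) (k : nat) (x : 'rV[R[i]]_k) : nat :=
  #|[pred i | x 0 i == 0]|.

Definition num_nonzero (R : realType) (k : nat) (x : 'rV[R[i]]_k) : nat :=
  #|[pred i | x 0 i != 0]|.

Definition subvector (T : Type) (k : nat) (x : 'rV[T]_k) (s : seq 'I_k) :
    'rV[T]_(size s) :=
  \row_(l < size s) x 0 (tnth (in_tuple s) l).

(* The list s enumerates all the indices by nondecreasing modulus of the
   entries of x; indices of equal modulus may come in any order. *)
Definition modulus_order (R : realType) (k : nat) (x : 'rV[R[i]]_k)
    (s : seq 'I_k) : Prop :=
  perm_eq s (enum 'I_k) /\
  sorted (fun a b : 'I_k => cmod (x 0 a) <= cmod (x 0 b)) s.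

Definition eliminable (R : realType) (p : \bar R) (q : R) (N k : nat)
    (x : 'rV[R[i]]_k) (s : seq 'I_k) (j : nat) : Prop :=
  (num_zero x <= j <= k - minn N (num_nonzero x))%N /\
  lpnorm p (subvector x (take j s)) <= (1 - q) * lpnorm p x.

(* A relation, not a function, because of the arbitrary choice made when
   several entries have the same modulus. *)
Definition vector_pattern (R : realType) (p : \bar R) (q : R) (N k : nat)
    (x : 'rV[R[i]]_k) (v : 'rV[bool]_k) : Prop :=
  if x == 0 then v = const_mx false
  else exists (s : seq 'I_k) (j : nat),
    [/\ modulus_order x s,
        eliminable p q N x s j,
        forall j' : nat, eliminable p q N x s j' -> (j' <= j)%N
      & forall i : 'I_k, v 0 i = (i \notin take j s)].

Definition sparsity_pattern (R : realType) (p : \bar R) (q : R)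
    (Nrow Ncol m n : nat) (A : 'M[R[i]]_(m, n)) (Z : 'M[bool]_(m, n)) : Prop :=
  exists rowZ colZ : 'M[bool]_(m, n),
    [/\ forall i : 'I_m, vector_pattern p q Nrow (row i A) (row i rowZ),
        forall j : 'I_n, vector_pattern p q Ncol (col j A)^T (col j colZ)^T
      & forall i j, Z i j = rowZ i j || colZ i j].

Definition sparsify (R : realType) (m n : nat) (Z : 'M[bool]_(m, n))
    (A : 'M[R[i]]_(m, n)) : 'M[R[i]]_(m, n) :=
  \matrix_(i, j) ((Z i j)%:R * A i j).

(* The operator norm induced by the Euclidean norms; written on the closed
   unit ball rather than the unit sphere so that it is 0 when n = 0. *)
Definition spectral_norm (R : realType) (m n : nat) (A : 'M[R[i]]_(m, n)) : R :=
  sup [set lpnorm 2%:E (A *m x)^T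
      | x in [set x : 'cV[R[i]]_n | lpnorm 2%:E x^T <= 1]].

(* fine p^-1 is 1/p, with the library convention +oo^-1 = 0. *)
Definition Cexp (R : realType) (p : \bar R) : R :=
  1 - fine p^-1%E + `|2^-1 - fine p^-1%E|.

(* Main.v *)
Require Import Defs.
From HB Require Import structures.
From mathcomp Require Import all_boot all_order all_algebra.
From mathcomp Require Import all_classical all_reals all_analysis.
From mathcomp Require Import complex.
From mathcomp Require Import ring lra.
Set Implicit Arguments.
Unset Strict Implicit.
Unset Printing Implicit Defensive.
Import Order.TTheory GRing.Theory Num.Theory.
Local Open Scope classical_set_scope.
Local Open Scope ring_scope.

(** Let [B] be the matrix [A - A^{pq}] of the entries that the pattern drops,
    and [s] the spectral norm of [A].  An entry is dropped only if the pattern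
    of its row and the pattern of its column both drop it.  So the p-norm of
    row i of [B] is at most that of the part which the row pattern eliminates,
    that is, at most [1 - q] times the p-norm of row i of [A]; the same holds
    for columns ([lpnorm_eliminated_le]).

    Two comparisons of norms on a space of dimension [k] turn this into a bound
    on absolute row and column sums: the 1-norm is at most [k^(1 - 1/p)] times
    the p-norm ([sum_le_lpnorm], the power mean inequality), and the p-norm is
    at most [k^|1/2 - 1/p|] times the 2-norm ([lpnorm_le_lpnorm2]).  The
    exponents add up to [C].  Since the 2-norm of any row or column of [A] is
    at most [s], the absolute row sums of [B] are at most [n^C (1 - q) s] and
    its absolute column sums at most [m^C (1 - q) s].

    Schur's test ([schur_test]) bounds the spectral norm of [B] by the geometric
    mean of these two bounds, which is [(mn)^(C/2) (1 - q) s]. *)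

(** * Power means and l_r norms of real families *)

(** Bernoulli's inequality [1 + u (t - 1) <= t^u] for real exponents: it is
    Young's inequality for [t * 1] with the exponent [u] and its conjugate. *)
Lemma bernoulli_powR (R : realType) (t u : R) :
  0 <= t -> 1 <= u -> u * t <= t `^ u + (u - 1).
Proof.
move=> t0; rewrite le_eqVlt => /predU1P[<-|u1].
  by rewrite powRr1// mul1r subrr addr0.
have u0 : 0 < u by lra.
have w0 : 0 < u / (u - 1) by rewrite divr_gt0//; lra.
have un0 : u != 0 by lra.
have um0 : u - 1 != 0 by lra.
have /(conjugate_powR t0 ler01 u0 w0) : u^-1 + (u / (u - 1))^-1 = 1.
  by field; rewrite un0 um0.
rewrite powR1 mulr1 mul1r => h.
have := ler_wpM2l (ltW u0) h; rewrite mulrDr; congr (_ <= _ + _); field => //.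
by rewrite um0 un0.
Qed.

(** Jensen's inequality for the power [u].  Dividing by the mean reduces it to
    the sum of Bernoulli's inequalities, since the deviations from the mean
    cancel. *)
Lemma powR_sum_le (R : realType) (n : nat) (b : 'I_n -> R) (u : R) :
  (forall i, 0 <= b i) -> 1 <= u ->
  (\sum_i b i) `^ u <= n%:R `^ (u - 1) * \sum_i b i `^ u.
Proof.
move=> b0 u1; set S := \sum_i b i.
have S0 : 0 <= S by apply: sumr_ge0.
have u0 : 0 < u by lra.
have [SE|Sn0] := eqVneq S 0.
  rewrite SE powR0 ?gt_eqF// mulr_ge0 ?powR_ge0//.
  by apply: sumr_ge0 => i _; exact: powR_ge0.
have Sgt0 : 0 < S by rewrite lt_def Sn0.
have n0 : 0 < n%:R :> R.
  rewrite ltr0n lt0n; apply: contra Sn0 => /eqP n0; rewrite /S.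
  by subst n; rewrite big_ord0.
pose M := S / n%:R.
have M0 : 0 < M by rewrite divr_gt0.
have SE : S = n%:R * M by rewrite /M mulrCA divff ?mulr1// gt_eqF.
have Mu0 : 0 < M `^ u by rewrite powR_gt0.
have h : n%:R <= (\sum_i b i `^ u) / M `^ u.
  have MVu : M^-1 `^ u = (M `^ u)^-1.
    by rewrite -[M^-1]powR_inv1 ?(ltW M0)// powRAC powR_inv1 ?powR_ge0.
  have : \sum_i (u * (b i / M)) <= \sum_i ((b i `^ u) / M `^ u + (u - 1)).
    apply: ler_sum => i _.
    have := @bernoulli_powR _ (b i / M) u (divr_ge0 (b0 i) (ltW M0)) u1.
    by rewrite powRM ?invr_ge0 ?(ltW M0)// MVu.
  rewrite -mulr_sumr -mulr_suml big_split/= -mulr_suml.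
  rewrite sumr_const card_ord -/S {1}SE mulfK ?gt_eqF//.
  rewrite -[(u - 1) *+ n]mulr_natl.
  by rewrite mulrBr mulr1 [u * _]mulrC addrCA lerDl subr_ge0.
rewrite ler_pdivlMr// in h.
rewrite SE powRM ?(ltW n0) ?(ltW M0)//.
rewrite -(@mulr_powRB1 _ n%:R u) ?(ltW n0)// [n%:R * _]mulrC -mulrA.
by apply: ler_wpM2l h; exact: powR_ge0.
Qed.

(** The l_r norm, for real families so that powers of a family are again
    families. *)
Definition ellnorm (R : realType) (r : R) (n : nat) (a : 'I_n -> R) : R :=
  (\sum_i a i `^ r) `^ r^-1.

Lemma ellnorm_power_mean (R : realType) (n : nat) (a : 'I_n -> R) (r s : R) :
  (forall i, 0 <= a i) -> 0 < r -> r <= s ->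
  ellnorm r a <= n%:R `^ (r^-1 - s^-1) * ellnorm s a.
Proof.
move=> a0 r0 rs.
have s0 : 0 < s by lra.
have rn0 : r != 0 by rewrite gt_eqF.
have sn0 : s != 0 by rewrite gt_eqF.
have := @powR_sum_le _ _ (fun i => a i `^ r) (s / r) (fun i => powR_ge0 _ _).
rewrite ler_pdivlMr// mul1r => /(_ rs).
have -> : \sum_i (a i `^ r) `^ (s / r) = \sum_i a i `^ s.
  by apply: eq_bigr => i _; rewrite -powRrM mulrCA divff// mulr1.
have P0 : 0 <= \sum_i a i `^ s by apply: sumr_ge0 => i _; exact: powR_ge0.
move=> /(@ge0_ler_powR _ s^-1 _ _ _ _ _); rewrite !nnegrE.
rewrite invr_ge0 (ltW s0) powR_ge0 mulr_ge0 ?powR_ge0//.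
move=> /(_ erefl erefl erefl).
rewrite powRM ?powR_ge0// -!powRrM.
have -> : s / r / s = r^-1 by field; rewrite rn0 sn0.
by have -> : (s / r - 1) / s = r^-1 - s^-1 by field; rewrite rn0 sn0.
Qed.

Lemma le_ellnorm (R : realType) (n : nat) (a : 'I_n -> R) (r : R) (i : 'I_n) :
  (forall i, 0 <= a i) -> 0 < r -> a i <= ellnorm r a.
Proof.
move=> a0 r0; have rn0 : r != 0 by rewrite gt_eqF.
rewrite -[leLHS](powRr1 (a0 i)) -(divff rn0) powRrM.
apply: ge0_ler_powR; rewrite ?invr_ge0 ?(ltW r0) ?nnegrE ?powR_ge0//.
  by apply: sumr_ge0 => j _; exact: powR_ge0.
rewrite (bigD1 i)//= lerDl; apply: sumr_ge0 => j _; exact: powR_ge0.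
Qed.

(** With [N] the r-norm, every entry is at most [N], so each s-th power is at
    most [N^(s - r)] times the r-th power. *)
Lemma ellnorm_decr (R : realType) (n : nat) (a : 'I_n -> R) (r s : R) :
  (forall i, 0 <= a i) -> 0 < r -> r <= s -> ellnorm s a <= ellnorm r a.
Proof.
move=> a0 r0 rs.
have s0 : 0 < s by lra.
have rn0 : r != 0 by rewrite gt_eqF.
have sn0 : s != 0 by rewrite gt_eqF.
set N := ellnorm r a; have N0 : 0 <= N by exact: powR_ge0.
have P0 t : 0 <= \sum_i a i `^ t by apply: sumr_ge0 => i _; exact: powR_ge0.
rewrite -[leRHS](powRr1 N0) -(divff sn0) powRrM.
apply: ge0_ler_powR; rewrite ?invr_ge0 ?(ltW s0) ?nnegrE ?powR_ge0//.
have key i : a i `^ s <= N `^ (s - r) * a i `^ r.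
  have [ai0|ain0] := eqVneq (a i) 0.
    by rewrite ai0 !powR0// mulr0.
  have -> : a i `^ s = a i `^ (s - r) * a i `^ r.
    by rewrite -powRD ?subrK// ain0 implybT.
  apply: ler_wpM2r; first exact: powR_ge0.
  by apply: ge0_ler_powR; rewrite ?subr_ge0 ?nnegrE//; exact: le_ellnorm.
apply: (le_trans (ler_sum _ (fun i _ => key i))); rewrite -mulr_sumr.
have -> : \sum_i a i `^ r = N `^ r by rewrite -powRrM mulVf// powRr1.
have [->|Nn0] := eqVneq N 0; first by rewrite [0 `^ r]powR0// mulr0 powR_ge0.
by rewrite -powRD ?subrK// Nn0 implybT.
Qed.

(** * Complex vectors *)

Lemma cmod_ge0 (R : realType) (z : R[i]) : 0 <= cmod z.
Proof. by case: z => a b; exact: sqrtr_ge0. Qed.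

Lemma cmod0 (R : realType) : cmod (0 : R[i]) = 0.
Proof. exact: ComplexField.Normc.normc0. Qed.

Lemma cmod1 (R : realType) : cmod (1 : R[i]) = 1.
Proof. exact: ComplexField.Normc.normc1. Qed.

Lemma cmodM (R : realType) (z w : R[i]) : cmod (z * w) = cmod z * cmod w.
Proof. exact: ComplexField.Normc.normcM. Qed.

Lemma cmod_sum (R : realType) (I : finType) (F : I -> R[i]) :
  cmod (\sum_i F i) <= \sum_i cmod (F i).
Proof.
elim/big_ind2: _ => [|x1 x2 y1 y2 h1 h2|//]; first by rewrite cmod0.
by apply: le_trans (lerD h1 h2); exact: le_normcD.
Qed.

Lemma lpnorm_finE (R : realType) (r : R) (k : nat) (x : 'rV[R[i]]_k) :
  lpnorm r%:E x = ellnorm r (fun i => cmod (x 0 i)).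
Proof. by []. Qed.

Lemma lpnorm_ge0 (R : realType) (p : \bar R) (k : nat) (x : 'rV[R[i]]_k) :
  0 <= lpnorm p x.
Proof.
case: p => [r| |]//=; first exact: powR_ge0.
by apply: bigmax_ge_id.
Qed.

Lemma lpnorm2E (R : realType) (k : nat) (x : 'rV[R[i]]_k) :
  lpnorm 2%:E x = Num.sqrt (\sum_i cmod (x 0 i) ^+ 2).
Proof.
rewrite /lpnorm powR12_sqrt; last by apply: sumr_ge0 => i _; exact: powR_ge0.
by congr Num.sqrt; apply: eq_bigr => i _; rewrite powR_mulrn// cmod_ge0.
Qed.

Lemma ereal_ge1P (R : realType) (p : \bar R) : (1 <= p)%E ->
  p = +oo%E \/ exists2 r : R, 1 <= r & p = r%:E.
Proof.
by case: p => [r| |]//; [rewrite lee_fin => ?; right; exists r | left].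
Qed.

Lemma fine_inver (R : realType) (r : R) : 0 < r -> fine (r%:E^-1)%E = r^-1.
Proof. by move=> r0; rewrite inver gt_eqF. Qed.

Lemma sum_le_lpnorm (R : realType) (p : \bar R) (k : nat) (x : 'rV[R[i]]_k) :
  (1 <= p)%E ->
  \sum_i cmod (x 0 i) <= k%:R `^ (1 - fine p^-1%E) * lpnorm p x.
Proof.
move=> /ereal_ge1P[->|[r r1 ->]].
  rewrite invey/= subr0 powRr1// mulr_natl -[X in _ *+ X](card_ord k).
  rewrite -sumr_const; apply: ler_sum => i _.
  exact: (le_bigmax _ (fun i => cmod (x 0 i))).
rewrite fine_inver ?lpnorm_finE; last by lra.
have := ellnorm_power_mean (fun i => cmod_ge0 (x 0 i)) ltr01 r1.
rewrite invr1; apply: le_trans.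
rewrite /ellnorm invr1 powRr1; last by apply: sumr_ge0 => i _; exact: powR_ge0.
by apply: ler_sum => i _; rewrite powRr1// cmod_ge0.
Qed.

(** The absolute value merges two regimes.  For [p <= 2] this is the power mean
    inequality.  For [p >= 2] the p-norm is already at most the 2-norm, and the
    factor is at least 1 as soon as the vector has an entry. *)
Lemma lpnorm_le_lpnorm2 (R : realType) (p : \bar R) (k : nat)
    (x : 'rV[R[i]]_k) : (1 <= p)%E ->
  lpnorm p x <= k%:R `^ `|2^-1 - fine p^-1%E| * lpnorm 2%:E x.
Proof.
have a0 (i : 'I_k) : 0 <= cmod (x 0 i) by exact: cmod_ge0.
have [k0|k0] := posnP k.
  subst k; move=> /ereal_ge1P[->|[r r1 ->]].
    by rewrite [leLHS]big_ord0 mulr_ge0 ?lpnorm_ge0 ?powR_ge0.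
  rewrite /= big_ord0 powR0; last by rewrite invr_eq0 gt_eqF//; lra.
  by rewrite mulr_ge0 ?powR_ge0.
have k1 : 1 <= k%:R `^ `|2^-1 - fine p^-1%E|.
  rewrite -{1}(powRr0 k%:R); apply: ler_powR => //.
  by rewrite ler1n.
have from_le : lpnorm p x <= lpnorm 2%:E x ->
    lpnorm p x <= k%:R `^ `|2^-1 - fine p^-1%E| * lpnorm 2%:E x.
  by move=> h; apply: (le_trans h); rewrite ler_peMl ?lpnorm_ge0.
move=> /ereal_ge1P[pE|[r r1 pE]].
  apply: from_le; rewrite {}pE /=.
  apply: bigmax_le => [|i _]; first exact: (lpnorm_ge0 2%:E).
  exact: (@le_ellnorm _ _ (fun i => cmod (x 0 i))).
have r0 : 0 < r by lra.
have [r2|r2] := leP 2 r.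
  by apply: from_le; rewrite pE; exact: ellnorm_decr.
rewrite pE fine_inver// distrC ger0_norm.
  exact: ellnorm_power_mean (ltW r2).
by rewrite subr_ge0 lef_pV2 ?posrE//; exact: ltW.
Qed.

(** * Schur's test *)

(** The Cauchy-Schwarz inequality with weights [w]. *)
Lemma sqr_sum_le (R : realFieldType) (I : finType) (w y : I -> R) :
  (forall i, 0 <= w i) ->
  (\sum_i w i * y i) ^+ 2 <= (\sum_i w i) * \sum_i w i * y i ^+ 2.
Proof.
move=> w0; set W := \sum_i w i; set T := \sum_i w i * y i.
set Q := \sum_i _ * _ ^+ 2.
have W0 : 0 <= W by apply: sumr_ge0.
have [WE|Wn0] := eqVneq W 0.
  have wE i : w i = 0.
    by apply: (@psumr_eq0P _ _ predT w) => // j _; exact: w0.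
  rewrite WE mul0r [T]big1 ?expr0n// => i _; by rewrite wE mul0r.
(* The weighted variance of y, scaled by W ^+ 2 to avoid dividing by W. *)
have : 0 <= \sum_i w i * (W * y i - T) ^+ 2.
  by apply: sumr_ge0 => i _; rewrite mulr_ge0 ?sqr_ge0.
have -> : \sum_i w i * (W * y i - T) ^+ 2 = W * (W * Q - T ^+ 2).
  transitivity (\sum_i (W ^+ 2 * (w i * y i ^+ 2) - (2 * W * T) * (w i * y i)
                        + T ^+ 2 * w i)).
    by apply: eq_bigr => i _; ring.
  by rewrite big_split sumrB/= -!mulr_sumr -/W -/T -/Q; ring.
by rewrite pmulr_rge0 ?subr_ge0// lt_def Wn0.
Qed.

(** In each row, Cauchy-Schwarz with the weights [cmod (B i j)] separates one
    factor bounded by the row sums; summing the other factor over the rows and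
    exchanging the sums makes the column sums appear. *)
Lemma schur_test (R : realType) (m n : nat) (B : 'M[R[i]]_(m, n)) (a b : R)
    (x : 'cV[R[i]]_n) :
  0 <= a -> 0 <= b -> (forall i, \sum_j cmod (B i j) <= a) ->
  (forall j, \sum_i cmod (B i j) <= b) ->
  lpnorm 2%:E (B *m x)^T <= Num.sqrt (a * b) * lpnorm 2%:E x^T.
Proof.
move=> a0 b0 rowB colB; rewrite !lpnorm2E.
have S0 : 0 <= \sum_i cmod (x^T 0 i) ^+ 2.
  by apply: sumr_ge0 => j _; exact: sqr_ge0.
rewrite -sqrtrM ?mulr_ge0//.
apply: ler_wsqrtr.
apply: (@le_trans _ _ (\sum_i a * \sum_j cmod (B i j) * cmod (x j 0) ^+ 2)).
  apply: ler_sum => i _; rewrite !mxE.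
  apply: le_trans (_ : (\sum_j cmod (B i j) * cmod (x j 0)) ^+ 2 <= _).
    rewrite ler_sqr ?nnegrE ?cmod_ge0//; last first.
      by apply: sumr_ge0 => j _; rewrite mulr_ge0 ?cmod_ge0.
    by apply: le_trans (cmod_sum _) _; apply: ler_sum => j _; rewrite cmodM.
  apply: le_trans (sqr_sum_le _ (fun j => cmod_ge0 (B i j))) _.
  apply: ler_wpM2r (rowB i).
  by apply: sumr_ge0 => j _; rewrite mulr_ge0 ?cmod_ge0 ?sqr_ge0.
rewrite -mulr_sumr -mulrA; apply: ler_wpM2l => //.
rewrite exchange_big mulr_sumr; apply: ler_sum => j _ /=.
by rewrite -mulr_suml mxE; apply: ler_wpM2r; rewrite ?sqr_ge0.
Qed.

(** * The spectral norm *)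

Lemma lpnorm2Z (R : realType) (k : nat) (c : R[i]) (x : 'rV[R[i]]_k) :
  lpnorm 2%:E (c *: x) = cmod c * lpnorm 2%:E x.
Proof.
rewrite !lpnorm2E -[in RHS](ger0_norm (cmod_ge0 c)) -sqrtr_sqr.
rewrite -sqrtrM ?sqr_ge0// mulr_sumr; congr Num.sqrt.
by apply: eq_bigr => i _; rewrite mxE cmodM exprMn.
Qed.

Lemma lpnorm0 (R : realType) (p : \bar R) (k : nat) :
  (1 <= p)%E -> lpnorm p (0 : 'rV[R[i]]_k) = 0.
Proof.
move=> p1; apply/eqP; rewrite eq_le lpnorm_ge0 andbT.
apply: le_trans (lpnorm_le_lpnorm2 _ p1) _.
by rewrite -(scale0r 0) lpnorm2Z cmod0 mul0r mulr0.
Qed.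

Lemma lpnorm2_eq0 (R : realType) (k : nat) (x : 'rV[R[i]]_k) :
  lpnorm 2%:E x = 0 -> x = 0.
Proof.
rewrite lpnorm2E => /eqP; rewrite sqrtr_eq0 => h.
apply/rowP => i; rewrite mxE; apply: ComplexField.Normc.eq0_normc.
apply/eqP; rewrite -sqrf_eq0; apply/eqP.
apply: (@psumr_eq0P _ _ predT (fun i => cmod (x 0 i) ^+ 2)) => //.
  by move=> j _; exact: sqr_ge0.
by apply/eqP; rewrite eq_le h sumr_ge0// => j _; exact: sqr_ge0.
Qed.

Lemma spectral_norm_le (R : realType) (m n : nat) (A : 'M[R[i]]_(m, n))
    (c : R) : 0 <= c ->
  (forall x, lpnorm 2%:E (A *m x)^T <= c * lpnorm 2%:E x^T) ->
  spectral_norm A <= c.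
Proof.
move=> c0 Ac; apply: ge_sup.
  by exists (lpnorm 2%:E (A *m 0)^T), 0 => //;
    rewrite /mkset trmx0 lpnorm0 ?lee_fin ?ler1n.
move=> _ [x /= x1 <-]; apply: le_trans (Ac x) _.
by rewrite ler_piMr.
Qed.

(** The supremum that defines the spectral norm is only meaningful for a bounded
    set.  Schur's test with a crude bound, the sum of the moduli of all the
    entries, provides boundedness. *)
Lemma spectral_norm_ub (R : realType) (m n : nat) (A : 'M[R[i]]_(m, n))
    (x : 'cV[R[i]]_n) : lpnorm 2%:E x^T <= 1 ->
  lpnorm 2%:E (A *m x)^T <= spectral_norm A.
Proof.
move=> x1; apply: ub_le_sup; last by exists x.
pose c := \sum_i \sum_j cmod (A i j).
have sum0 i : 0 <= \sum_j cmod (A i j).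
  by apply: sumr_ge0 => j _; exact: cmod_ge0.
have c0 : 0 <= c by apply: sumr_ge0.
exists (Num.sqrt (c * c)) => _ [y /= y1 <-].
apply: le_trans (schur_test y c0 c0 _ _) _.
- by move=> i; rewrite /c (bigD1 i)//= lerDl sumr_ge0.
- move=> j; apply: ler_sum => i _.
  by rewrite (bigD1 j)//= lerDl sumr_ge0// => l _; exact: cmod_ge0.
- by rewrite ler_piMr ?sqrtr_ge0.
Qed.

Lemma spectral_normP (R : realType) (m n : nat) (A : 'M[R[i]]_(m, n))
    (x : 'cV[R[i]]_n) :
  lpnorm 2%:E (A *m x)^T <= spectral_norm A * lpnorm 2%:E x^T.
Proof.
set N := lpnorm 2%:E x^T.
have [NE|Nn0] := eqVneq N 0.
  have -> : x = 0 by apply/trmx_inj; rewrite trmx0; exact: lpnorm2_eq0.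
  by rewrite mulmx0 trmx0 lpnorm0 ?lee_fin ?ler1n// NE mulr0.
have N0 : 0 < N by rewrite lt_def Nn0 lpnorm_ge0.
have cE : cmod ((N^-1)%:C%C) = N^-1.
  by rewrite /cmod /= expr0n addr0 sqrtr_sqr ger0_norm// invr_ge0 ltW.
have := @spectral_norm_ub _ _ _ A ((N^-1)%:C%C *: x).
rewrite -scalemxAr !linearZ_LR !lpnorm2Z cE -/N mulVf// => /(_ (lexx _)).
by rewrite mulrC ler_pdivrMr.
Qed.

Lemma spectral_norm_ge0 (R : realType) (m n : nat) (A : 'M[R[i]]_(m, n)) :
  0 <= spectral_norm A.
Proof.
apply: le_trans (lpnorm_ge0 2%:E (A *m 0)^T) _; apply: spectral_norm_ub.
by rewrite trmx0 lpnorm0 ?lee_fin ?ler1n.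
Qed.

Lemma col_le_spectral_norm (R : realType) (m n : nat) (A : 'M[R[i]]_(m, n))
    (j : 'I_n) : lpnorm 2%:E (col j A)^T <= spectral_norm A.
Proof.
rewrite colE; apply: spectral_norm_ub.
rewrite trmx_delta lpnorm2E (bigD1 j)//= big1 => [|l lj].
  by rewrite mxE !eqxx cmod1 expr1n addr0 sqrtr1.
by rewrite mxE eqxx (negbTE lj) cmod0 expr0n.
Qed.

(** The conjugate of the row is mapped to a vector whose i-th entry is the
    square of the norm of the row. *)
Lemma row_le_spectral_norm (R : realType) (m n : nat) (A : 'M[R[i]]_(m, n))
    (i : 'I_m) : lpnorm 2%:E (row i A) <= spectral_norm A.
Proof.
set N := lpnorm _ _.
have sqN : N ^+ 2 = \sum_j cmod (A i j) ^+ 2.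
  rewrite /N lpnorm2E sqr_sqrtr; last by apply: sumr_ge0 => j _; exact: sqr_ge0.
  by apply: eq_bigr => j _; rewrite mxE.
have [->|Nn0] := eqVneq N 0; first exact: spectral_norm_ge0.
have N0 : 0 < N by rewrite lt_def Nn0 lpnorm_ge0.
pose x : 'cV[R[i]]_n := \col_j (A i j)^*%C.
have xE : lpnorm 2%:E x^T = N.
  rewrite /N !lpnorm2E; congr Num.sqrt; apply: eq_bigr => j _; rewrite !mxE.
  by case: (A i j) => u v; rewrite /cmod /= sqrrN.
have AxE : (A *m x) i 0 = (N ^+ 2)%:C%C.
  rewrite !mxE sqN rmorph_sum; apply: eq_bigr => j _; rewrite mxE.
  by rewrite -sqr_normc -rmorphXn.
have : N ^+ 2 <= spectral_norm A * N.
  rewrite -{2}xE; apply: le_trans (spectral_normP A x).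
  have -> : N ^+ 2 = cmod ((A *m x)^T 0 i).
    by rewrite mxE AxE /cmod /= expr0n addr0 sqrtr_sqr ger0_norm ?sqr_ge0.
  apply: (@le_ellnorm _ _ (fun i => cmod ((A *m x)^T 0 i))) => [l|//].
  exact: cmod_ge0.
by rewrite expr2 ler_pM2r.
Qed.

(** * Eliminated entries *)

(** [y] is allowed to keep only part of what the pattern eliminates: an entry
    eliminated by the pattern of its row vanishes from the dropped matrix when
    the pattern of its column preserves it. *)
Lemma lpnorm_eliminated_le (R : realType) (p : \bar R) (q : R) (N k : nat)
    (x y : 'rV[R[i]]_k) (v : 'rV[bool]_k) : (1 <= p)%E -> q <= 1 ->
  vector_pattern p q N x v ->
  (forall i, y 0 i = 0 \/ ~~ v 0 i /\ y 0 i = x 0 i) ->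
  lpnorm p y <= (1 - q) * lpnorm p x.
Proof.
move=> p1 q1; rewrite /vector_pattern; case: eqVneq => [-> _ yx|_].
  have -> : y = 0.
    by apply/rowP => i; rewrite mxE; case: (yx i) => // -[_ ->]; rewrite mxE.
  by rewrite lpnorm0// mulr0.
move=> [s [j [[perm_s _] [_ small] _ vE]]] yx; apply: le_trans small.
set t := take j s.
have {yx} yP i : y 0 i = 0 \/ i \in t /\ y 0 i = x 0 i.
  by case: (yx i) => [|[]]; [left | rewrite vE negbK; right].
case/ereal_ge1P: p1 => [->|[r r1 ->]] /=.
  have M0 := lpnorm_ge0 +oo%E (subvector x t).
  apply: bigmax_le => // i _.
  case: (yP i) => [->|[it ->]]; first by rewrite cmod0.
  have /tnthP[l ->] : i \in in_tuple t by [].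
  apply: le_trans (le_bigmax _ _ l).
  by rewrite mxE.
have r0 : 0 < r by lra.
apply: ge0_ler_powR; rewrite ?nnegrE ?invr_ge0 ?(ltW r0) ?sumr_ge0//.
1,2: by move=> *; exact: powR_ge0.
have t_uniq : uniq t by rewrite take_uniq// (perm_uniq perm_s) enum_uniq.
have -> : \sum_l cmod (subvector x t 0 l) `^ r
          = \sum_(i <- t) cmod (x 0 i) `^ r.
  by rewrite [RHS]big_tnth; apply: eq_bigr => l _; rewrite mxE.
rewrite [leRHS]big_uniq// [leRHS]big_mkcond; apply: ler_sum => i _.
case: (yP i) => [->|[-> ->]//].
by rewrite cmod0 powR0 ?gt_eqF//; case: ifP => // _; exact: powR_ge0.
Qed.

Lemma lpnorm_eliminated_sum_le (R : realType) (p : \bar R) (q : R) (N k : nat)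
    (x y : 'rV[R[i]]_k) (v : 'rV[bool]_k) : (1 <= p)%E -> q <= 1 ->
  vector_pattern p q N x v ->
  (forall i, y 0 i = 0 \/ ~~ v 0 i /\ y 0 i = x 0 i) ->
  \sum_i cmod (y 0 i) <= k%:R `^ Cexp p * ((1 - q) * lpnorm 2%:E x).
Proof.
move=> p1 q1 xv yx.
(* The exponents add up only over a nonzero base, since 0 `^ 0 = 1. *)
have [k0|k0] := posnP k.
  subst k; rewrite big_ord0 mulr_ge0 ?powR_ge0// mulr_ge0 ?lpnorm_ge0//.
  by rewrite subr_ge0.
apply: le_trans (sum_le_lpnorm y p1) _.
have CE : k%:R `^ Cexp p =
    k%:R `^ (1 - fine p^-1%E) * k%:R `^ `|2^-1 - fine p^-1%E| :> R.
  by rewrite -powRD// pnatr_eq0 -lt0n k0 implybT.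
rewrite CE -mulrA; apply: ler_wpM2l; first exact: powR_ge0.
apply: le_trans (lpnorm_eliminated_le p1 q1 xv yx) _.
rewrite mulrCA; apply: ler_wpM2l; first by rewrite subr_ge0.
exact: lpnorm_le_lpnorm2.
Qed.


Theorem theorem4p2 (R : realType) (m n Nrow Ncol : nat) (A : 'M[R[i]]_(m, n))
    (p : \bar R) (q : R) (Z : 'M[bool]_(m, n))
    (hp : (1 <= p)%E) (hq : 0 <= q <= 1)
    (hZ : sparsity_pattern p q Nrow Ncol A Z) :
  spectral_norm (A - sparsify Z A)
    <= (m * n)%:R `^ (Cexp p / 2) * (1 - q) * spectral_norm A.
Proof.
have /andP[_ q1] := hq.
case: hZ => [rowZ [colZ [row_pat col_pat ZE]]].
set B := A - sparsify Z A; set s := spectral_norm A.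
have BE i j : B i j = 0 \/ ~~ rowZ i j /\ ~~ colZ i j /\ B i j = A i j.
  rewrite !mxE ZE; case: (rowZ i j); case: (colZ i j) => /=;
    rewrite ?mul1r ?mul0r ?subrr ?subr0; by [left | right].
have qs0 : 0 <= (1 - q) * s by rewrite mulr_ge0 ?subr_ge0 ?spectral_norm_ge0.
have rowB i : \sum_j cmod (B i j) <= n%:R `^ Cexp p * ((1 - q) * s).
  apply: le_trans (_ : n%:R `^ Cexp p * ((1 - q) * lpnorm 2%:E (row i A)) <= _).
    have -> : \sum_j cmod (B i j) = \sum_j cmod (row i B 0 j).
      by apply: eq_bigr => j _; rewrite [row i B 0 j]mxE.
    apply: (lpnorm_eliminated_sum_le hp q1 (row_pat i)) => j; rewrite !mxE.
    by have := BE i j; rewrite !mxE => -[|[? [_ ?]]]; [left | right].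
  apply: ler_wpM2l; first exact: powR_ge0.
  by apply: ler_wpM2l; [rewrite subr_ge0 | exact: row_le_spectral_norm].
have colB j : \sum_i cmod (B i j) <= m%:R `^ Cexp p * ((1 - q) * s).
  apply: le_trans
    (_ : m%:R `^ Cexp p * ((1 - q) * lpnorm 2%:E (col j A)^T) <= _).
    have -> : \sum_i cmod (B i j) = \sum_i cmod ((col j B)^T 0 i).
      by apply: eq_bigr => i _; rewrite [_^T 0 i]mxE [col j B i 0]mxE.
    apply: (lpnorm_eliminated_sum_le hp q1 (col_pat j)) => i; rewrite !mxE.
    by have := BE i j; rewrite !mxE => -[|[_ [? ?]]]; [left | right].
  apply: ler_wpM2l; first exact: powR_ge0.
  by apply: ler_wpM2l; [rewrite subr_ge0 | exact: col_le_spectral_norm].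
have -> : (m * n)%:R `^ (Cexp p / 2) * (1 - q) * s =
    Num.sqrt ((n%:R `^ Cexp p * ((1 - q) * s)) *
              (m%:R `^ Cexp p * ((1 - q) * s))).
  rewrite mulrACA -powRM// -natrM [(n * m)%N]mulnC -expr2.
  rewrite sqrtrM ?powR_ge0// sqrtr_sqr ger0_norm// powRrM.
  by rewrite powR12_sqrt ?powR_ge0// mulrA.
apply: spectral_norm_le; first exact: sqrtr_ge0.
by move=> x; apply: schur_test => //; rewrite mulr_ge0 ?powR_ge0.
Qed.
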